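(* Let $x^*\in S$ be a feasible point of (VQFP). Suppose that $h_j$ is convex for each $j\in J$ and that there exist vectors $\tau\in\mathbb{R}^m$, $\lambda\in\mathbb{R}^\ell$ such that $$\sum_{i=1}^m \tau_i \nabla\Big(\frac{f_i}{g_i}\Big)(x^* )+\sum_{j=1}^\ell \lambda_j\nabla h_j(x^* )=0,\qquad \sum_{j=1}^\ell \lambda_j h_j(x^* )=0,\qquad \tau_i>0\ (i\in I),\quad \lambda_j\ge 0\ (j\in J).$$ If for every $x\in S$ $$\sum_{i=1}^m \tau_i\frac{s_i(x,x^* )}{u_i(x,x^* )}\ge 0,$$ then $x^*$ is a Pareto optimal solution of (VQFP).
   Context: Setting. Let $m,\ell,n\ge 1$, $I=\{1,\dots,m\}$, $J=\{1,\dots,\ell\}$, and let $\Omega\subseteq\mathbb{R}^n$ be open. For $i\in I$ and $x\in\mathbb{R}^n$ let $f_i(x)=x^TA_ix+a_i^Tx+\bar a_i$ and $g_i(x)=x^TB_ix+b_i^Tx+\bar b_i$, where $A_i,B_i\in\mathbb{R}^{n\times n}$ are symmetric, $B_i$ is positive semidefinite, $a_i,b_i\in\mathbb{R}^n$, $\bar a_i,\bar b_i\in\mathbb{R}$; the system $2B_ix+b_i=0$ is assumed to have a solution $w^i$, and $\bar b_i>-((w^i)^TB_iw^i+b_i^Tw^i)$, so that $g_i(x)>0$ for all $x\in\mathbb{R}^n$. The functions $h_j:\Omega\to\mathbb{R}$, $j\in J$, are continuously differentiable. The feasible set is $S=\{x\in\Omega: h_j(x)\le 0\ \forall j\in J\}$.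 (VQFP) is the vector problem of minimizing $\big(\frac{f_1(x)}{g_1(x)},\dots,\frac{f_m(x)}{g_m(x)}\big)$ over $x\in S$. A point $x^*\in S$ is a Pareto optimal solution of (VQFP) if there is no $x\in S$ with $\frac{f_i(x)}{g_i(x)}\le\frac{f_i(x^* )}{g_i(x^* )}$ for all $i\in I$ and strict inequality for at least one $i$. Convexity of a differentiable function $h:\Omega\to\mathbb{R}$: $\Omega$ is convex and $h(x)-h(y)\ge\nabla h(y)^T(x-y)$ for all $x,y\in\Omega$. For $x,x^*\in S$ and $i\in I$: $u_i(x,x^* )=\frac{g_i(x^* )}{g_i(x)}$ and $s_i(x,x^* )=\frac{1}{g_i(x)}(x-x^* )^T\big[A_i-\frac{f_i(x^* )}{g_i(x^* )}B_i\big](x-x^* )$. *)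

(* Defs.v *)
From HB Require Import structures.
From mathcomp Require Import all_boot all_order all_algebra sesquilinear.
From mathcomp Require Import all_classical all_reals all_analysis.
Export numFieldNormedType.Exports.

Set Implicit Arguments.
Unset Strict Implicit.
Unset Printing Implicit Defensive.
Import Order.TTheory GRing.Theory Num.Theory.

Local Open Scope classical_set_scope.
Local Open Scope ring_scope.

Definition dotv (R : realType) (n : nat) (u v : 'cV[R]_n) : R :=
  (u^T *m v) 0 0.

Definition qform (R : realType) (n : nat) (A : 'M[R]_n) (x : 'cV[R]_n) : R :=
  (x^T *m A *m x) 0 0.

Definition possemidef (R : realType) (n : nat) (A : 'M[R]_n) : Prop :=
  forall x : 'cV[R]_n, 0 <= qform A x.

Definition quadfun (R : realType) (n : nat)
    (A : 'M[R]_n) (a : 'cV[R]_n) (c : R) (x : 'cV[R]_n) : R :=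
  qform A x + dotv a x + c.

(* [delta_mx k 0] is the [k]-th vector of the canonical basis, so the entries
   of [grad h x] are the partial derivatives of [h] at [x]. *)
Definition grad (R : realType) (n : nat) (h : 'cV[R]_n -> R) (x : 'cV[R]_n) :
    'cV[R]_n :=
  \col_(k < n) 'D_(delta_mx k 0) h x.

(* A function on an open set [Omega] is represented by a total function; for
   [x] in [Omega], differentiability and [grad h x] depend only on the values
   of [h] near [x], hence only on its restriction to [Omega]. *)
Definition cont_differentiable_on (R : realType) (n : nat)
    (Omega : set 'cV[R]_n) (h : 'cV[R]_n -> R) : Prop :=
  (forall x, Omega x -> differentiable h x) /\
  {within Omega, continuous (grad h)}.

Definition convex_on (R : realType) (n : nat)
    (Omega : set 'cV[R]_n) (h : 'cV[R]_n -> R) : Prop :=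
  convex_set Omega /\
  forall x y, Omega x -> Omega y -> h x - h y >= dotv (grad h y) (x - y).

Definition feasible_set (R : realType) (n l : nat)
    (Omega : set 'cV[R]_n) (h : 'I_l -> 'cV[R]_n -> R) : set 'cV[R]_n :=
  [set x | Omega x /\ forall j, h j x <= 0].

Definition pareto_optimal (R : realType) (T : Type) (m : nat)
    (S : set T) (F : 'I_m -> T -> R) (xs : T) : Prop :=
  S xs /\
  ~ (exists x, [/\ S x, forall i, F i x <= F i xs & exists i, F i x < F i xs]).

Definition u_ratio (R : realType) (n : nat) (g : 'cV[R]_n -> R)
    (x xs : 'cV[R]_n) : R :=
  g xs / g x.

Definition s_term (R : realType) (n : nat) (A B : 'M[R]_n)
    (f g : 'cV[R]_n -> R) (x xs : 'cV[R]_n) : R :=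
  1 / g x * qform (A - (f xs / g xs) *: B) (x - xs).

(* Main.v *)
(* Put F_i = f_i / g_i.  The function f_i - F_i(xs) g_i is quadratic and
   vanishes at xs, so its exact second-order expansion there gives
     (F_i(x) - F_i(xs)) / u_i = grad F_i(xs) . (x - xs) + s_i / u_i.
   Weighting by tau and using stationarity, convexity of the h_j and
   complementarity, the sum of tau_i (F_i(x) - F_i(xs)) / u_i is nonnegative
   for feasible x; as tau_i / u_i > 0, no feasible x can dominate xs. *)
Require Import Defs.
From HB Require Import structures.
From mathcomp Require Import all_boot all_order all_algebra sesquilinear.
From mathcomp Require Import all_classical all_reals all_analysis.
From mathcomp Require Import ring.

Set Implicit Arguments.
Unset Strict Implicit.
Unset Printing Implicit Defensive.
Import Order.TTheory GRing.Theory Num.Theory.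

Local Open Scope classical_set_scope.
Local Open Scope ring_scope.

Lemma dotvDl (R : realType) (n : nat) (u v w : 'cV[R]_n) :
  dotv (u + v) w = dotv u w + dotv v w.
Proof. by rewrite /dotv linearD mulmxDl mxE. Qed.

Lemma dotvZl (R : realType) (n : nat) (k : R) (u w : 'cV[R]_n) :
  dotv (k *: u) w = k * dotv u w.
Proof. by rewrite /dotv linearZ -scalemxAl mxE. Qed.

Lemma dot0v (R : realType) (n : nat) (w : 'cV[R]_n) : dotv 0 w = 0.
Proof. by rewrite /dotv trmx0 mul0mx mxE. Qed.

Lemma dotvDr (R : realType) (n : nat) (w u v : 'cV[R]_n) :
  dotv w (u + v) = dotv w u + dotv w v.
Proof. by rewrite /dotv mulmxDr mxE. Qed.

Lemma dotvZr (R : realType) (n : nat) (k : R) (w u : 'cV[R]_n) :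
  dotv w (k *: u) = k * dotv w u.
Proof. by rewrite /dotv -scalemxAr mxE. Qed.

Lemma dotv_suml (R : realType) (n m : nat) (u : 'I_m -> 'cV[R]_n) (w : 'cV[R]_n) :
  dotv (\sum_(i < m) u i) w = \sum_(i < m) dotv (u i) w.
Proof. by rewrite /dotv linear_sum mulmx_suml summxE. Qed.

Lemma dotv_delta (R : realType) (n : nat) (u : 'cV[R]_n) (k : 'I_n) :
  dotv u (delta_mx k 0) = u k 0.
Proof. by rewrite /dotv -colE !mxE. Qed.

Lemma qformZ (R : realType) (n : nat) (A : 'M[R]_n) (k : R) (x : 'cV[R]_n) :
  qform A (k *: x) = k ^+ 2 * qform A x.
Proof.
by rewrite /qform -scalemxAr [(k *: x)^T]linearZ -!scalemxAl !mxE mulrA expr2.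
Qed.

Lemma qformBZ (R : realType) (n : nat) (A B : 'M[R]_n) (k : R) (x : 'cV[R]_n) :
  qform (A - k *: B) x = qform A x - k * qform B x.
Proof.
by rewrite /qform mulmxBr mulmxBl -scalemxAr -scalemxAl !mxE.
Qed.

(** The cross terms [x^T *m A *m d] and [d^T *m A *m x] are transposes of each other once [A] is
    symmetric, so they merge into the gradient term and no remainder is left. *)
Lemma quadfunD (R : realType) (n : nat) (A : 'M[R]_n) (a : 'cV[R]_n) (c : R)
    (x d : 'cV[R]_n) :
  A \is symmetricmx ->
  quadfun A a c (x + d) =
  quadfun A a c x + dotv (2 *: (A *m x) + a) d + qform A d.
Proof.
(* [symmetricmx] is the hermitian predicate with trivial sign and identity conjugation; clearing
   both leaves [A = A^T]. *)
move=> /is_hermitianmxP; rewrite expr0 scale1r map_mx_id // => AT.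
have xAd : (x^T *m A *m d) 0 0 = dotv (A *m x) d.
  by rewrite /dotv trmx_mul -AT.
have dAx : (d^T *m A *m x) 0 0 = dotv (A *m x) d.
  have -> : d^T *m A *m x = (x^T *m A *m d)^T.
    by rewrite !trmx_mul trmxK -AT mulmxA.
  by rewrite mxE.
have addE (M N : 'M[R]_1) : (M + N) 0 0 = M 0 0 + N 0 0 by rewrite mxE.
rewrite /quadfun dotvDr dotvDl dotvZl /qform [(x + d)^T]linearD /= !mulmxDl !mulmxDr !addE.
by rewrite xAd dAx; ring.
Qed.

(** Expanding at the critical point [w] kills the linear term; what remains is the value at [w],
    positive by the bound on [c], plus a nonnegative form. *)
Lemma quadfun_gt0 (R : realType) (n : nat) (B : 'M[R]_n) (b : 'cV[R]_n) (c : R)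
    (w : 'cV[R]_n) :
  B \is symmetricmx -> possemidef B -> 2 *: (B *m w) + b = 0 ->
  c > - (qform B w + dotv b w) -> forall x, 0 < quadfun B b c x.
Proof.
move=> Bsym Bpsd w0 cw x; rewrite -(subrKC w x) quadfunD // w0 dot0v addr0.
by apply: ltr_wpDr => //; rewrite /quadfun -ltrBlDl sub0r.
Qed.

(** For [t != 0], [quadfunD] makes the difference quotient equal to [L + t * qform A v], which tends
    to [L]. *)
Lemma is_derive_quadfun (R : realType) (n : nat) (A : 'M[R]_n) (a : 'cV[R]_n)
    (c : R) (x v : 'cV[R]_n) :
  A \is symmetricmx ->
  is_derive x v (quadfun A a c) (dotv (2 *: (A *m x) + a) v).
Proof.
move=> Asym; set L := dotv _ v.
suff lim : (fun t : R => t^-1 *: (quadfun A a c (t *: v + x) - quadfun A a c x))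
    @ 0^' --> L.
  by apply: DeriveDef; [apply/cvg_ex; exists L | exact: cvg_lim lim].
have : (fun t : R => L + t * qform A v) @ 0^' --> L.
  rewrite -[X in _ --> X]addr0 -[X in _ --> _ + X](mul0r (qform A v)).
  by apply: cvgD; [exact: cvg_cst | apply: cvgMr_tmp; exact: cvg_within].
apply: cvg_trans; apply: near_eq_cvg; near=> t.
have t0 : t != 0 by near: t; exact: (nbhs_dnbhs_neq (0 : R)).
rewrite addrC [t *: v + x]addrC quadfunD // dotvZr qformZ -/L /GRing.scale /=.
by field.
Unshelve. all: by end_near. Qed.

(** The quotient rule, grouped as the gradient of [f - (f x / g x) g] over [g x] to match the matrix
    in [s_term]. *)
Lemma grad_quadfun_div (R : realType) (n : nat) (A B : 'M[R]_n)
    (a b : 'cV[R]_n) (c e : R) (x : 'cV[R]_n)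
    (f := quadfun A a c) (g := quadfun B b e) :
  A \is symmetricmx -> B \is symmetricmx -> g x != 0 ->
  grad (fun y => f y / g y) x =
  (g x)^-1 *: (2 *: (A *m x) + a + (- (f x / g x)) *: (2 *: (B *m x) + b)).
Proof.
move=> Asym Bsym gx0; apply/colP => k; rewrite /grad mxE.
have [df vf] := is_derive_quadfun a c x (delta_mx k 0) Asym.
have [dg vg] := is_derive_quadfun b e x (delta_mx k 0) Bsym.
rewrite (deriveM df (derivableV gx0 dg)) deriveV // vf vg !dotv_delta.
rewrite [in RHS]mxE [in RHS]mxE [(_ *: (_ + b)) _ _]mxE /GRing.scale /= -/f -/g.
by field.
Qed.

(** Dividing by [u_ratio] cancels the denominator [g x]: the left side is
    [(f x - (f y / g y) * g x) / g y], whose numerator is quadratic in [x]. *)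
Lemma quadfun_div_expansion (R : realType) (n : nat) (A B : 'M[R]_n)
    (a b : 'cV[R]_n) (c e : R) (x y : 'cV[R]_n)
    (f := quadfun A a c) (g := quadfun B b e) :
  A \is symmetricmx -> B \is symmetricmx -> g x != 0 -> g y != 0 ->
  (f x / g x - f y / g y) / u_ratio g x y =
  dotv (grad (fun z => f z / g z) y) (x - y) + s_term A B f g x y / u_ratio g x y.
Proof.
move=> Asym Bsym gx0 gy0; rewrite grad_quadfun_div // -/f -/g.
have fx := quadfunD a c y (x - y) Asym.
have gx := quadfunD b e y (x - y) Bsym.
rewrite subrKC -/f in fx; rewrite subrKC -/g in gx.
rewrite dotvZl dotvDl dotvZl /s_term /u_ratio qformBZ fx.
(* Solving for the linear part of [g], rather than expanding [g x], keeps the denominators atomic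
   for [field]. *)
have -> : dotv (2 *: (B *m y) + b) (x - y) = g x - g y - qform B (x - y).
  by rewrite gx; ring.
by field; rewrite gx0 gy0.
Qed.

Theorem theorem3p1 (R : realType) (m l n : nat)
    (m_gt0 : (0 < m)%N) (l_gt0 : (0 < l)%N) (n_gt0 : (0 < n)%N)
    (Omega : set 'cV[R]_n) (Omega_open : open Omega)
    (A B : 'I_m -> 'M[R]_n) (a b : 'I_m -> 'cV[R]_n) (abar bbar : 'I_m -> R)
    (A_sym : forall i, A i \is symmetricmx)
    (B_sym : forall i, B i \is symmetricmx)
    (B_psd : forall i, possemidef (B i))
    (w : 'I_m -> 'cV[R]_n)
    (w_sol : forall i, 2 *: (B i *m w i) + b i = 0)
    (bbar_gt : forall i, bbar i > - (qform (B i) (w i) + dotv (b i) (w i)))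
    (h : 'I_l -> 'cV[R]_n -> R)
    (h_C1 : forall j, cont_differentiable_on Omega (h j))
    (f := fun i => quadfun (A i) (a i) (abar i))
    (g := fun i => quadfun (B i) (b i) (bbar i))
    (S := feasible_set Omega h)
    (xs : 'cV[R]_n) (xs_feasible : S xs)
    (h_convex : forall j, convex_on Omega (h j))
    (tau : 'cV[R]_m) (lambda : 'cV[R]_l)
    (stationarity :
      \sum_(i < m) tau i 0 *: grad (fun x => f i x / g i x) xs
      + \sum_(j < l) lambda j 0 *: grad (h j) xs = 0)
    (complementarity : \sum_(j < l) lambda j 0 * h j xs = 0)
    (tau_gt0 : forall i, tau i 0 > 0)
    (lambda_ge0 : forall j, lambda j 0 >= 0)
    (s_cond : forall x, S x ->
      \sum_(i < m) tau i 0 * (s_term (A i) (B i) (f i) (g i) x xs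
                              / u_ratio (g i) x xs) >= 0) :
  pareto_optimal S (fun i x => f i x / g i x) xs.
Proof.
have g_gt0 i x : 0 < g i x by exact: quadfun_gt0.
have u_gt0 i x : 0 < u_ratio (g i) x xs by rewrite divr_gt0.
split=> // -[x [Sx le_F [i0 lt_F]]].
pose F i x := f i x / g i x.
(* Domination by [x] makes every term nonpositive and the term at [i0] strictly negative. *)
have : \sum_(i < m) tau i 0 * ((F i x - F i xs) / u_ratio (g i) x xs) < 0.
  rewrite (bigD1 i0) //= ltr_nwDl //; last first.
    apply: sumr_le0 => i _; rewrite pmulr_rle0 // pmulr_lle0 ?invr_gt0 //.
    by rewrite subr_le0; exact: le_F.
  by rewrite pmulr_rlt0 // pmulr_llt0 ?invr_gt0 // subr_lt0.
apply/negP; rewrite -leNgt.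
have expand i : (F i x - F i xs) / u_ratio (g i) x xs =
    dotv (grad (F i) xs) (x - xs)
    + s_term (A i) (B i) (f i) (g i) x xs / u_ratio (g i) x xs.
  by apply: quadfun_div_expansion; rewrite // gt_eqF ?g_gt0.
under eq_bigr do rewrite expand mulrDr.
rewrite big_split /= addr_ge0 ?s_cond //.
(* After [s_cond], only the gradient terms remain. Pairing stationarity with [x - xs] turns their
   sum into minus the [lambda]-weighted one, which must then be shown nonpositive. *)
have /(congr1 (fun v => dotv v (x - xs))) := stationarity.
rewrite dotvDl dot0v !dotv_suml.
under eq_bigr do rewrite -dotvZl.
move=> /eqP; rewrite addr_eq0 => /eqP ->; rewrite oppr_ge0.
have [Ox hx] := Sx; have [Oxs _] := xs_feasible.
(* Convexity bounds each gradient term by an increment of [h j]; complementarity removes the values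
   at [xs], and feasibility of [x] gives the sign. *)
apply: (@le_trans _ _ (\sum_(j < l) lambda j 0 * (h j x - h j xs))).
  apply: ler_sum => j _; rewrite dotvZl ler_wpM2l //.
  exact: (h_convex j).2.
under eq_bigr do rewrite mulrBr.
rewrite sumrB complementarity subr0.
by apply: sumr_le0 => j _; rewrite mulr_ge0_le0.
Qed.
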